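(* Let $\delta\in\mathbb{C}$ with $\delta\neq-1$ and $\delta\neq1$. The variety of commutative $\delta$-Leibniz algebras over $\mathbb{C}$ coincides with the variety of commutative $\frac{\delta}{1-\delta}$-associative algebras. In particular, the variety of commutative $\tfrac12$-Leibniz algebras coincides with the variety of commutative associative algebras; and, if in addition $\delta\neq\tfrac12$, the variety of commutative $\delta$-Leibniz algebras is a subvariety of the variety of commutative $3$-step nilpotent algebras.
   Context: An algebra means a complex vector space with a bilinear multiplication, not assumed associative. For $\delta\in\mathbb{C}$, a $\delta$-Leibniz algebra satisfies $(xy)z=\delta\big((xz)y+x(yz)\big)$ for all $x,y,z$. For $\varepsilon\in\mathbb{C}$, an $\varepsilon$-associative algebra satisfies $(xy)z=\varepsilon\, x(yz)$ for all $x,y,z$. An algebra is $3$-step nilpotent if every product of four elements, with any bracketing, is zero. *)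

(* Defs.v *)
(* MathComp world; complex numbers are R[i] for R : realType. *)
From mathcomp Require Import all_boot all_order all_algebra.
From mathcomp Require Import reals.
From mathcomp Require Import complex.

Set Implicit Arguments.
Unset Strict Implicit.
Unset Printing Implicit Defensive.

Import GRing.Theory.
Local Open Scope ring_scope.

(* No associativity, unit or finite-dimensionality is assumed. *)
Record algebra (F : fieldType) := Algebra {
  carrier :> lmodType F;
  mul : {bilinear carrier -> carrier -> carrier}
}.

Notation "x ** y" := (mul _ x y) (at level 40, left associativity) : ring_scope.

Section Classes.

Variable F : fieldType.
Implicit Types (A : algebra F) (K L : algebra F -> Prop).

Definition comm_alg A := forall x y : A, x ** y = y ** x.

Definition leibniz (delta : F) A :=
  forall x y z : A, (x ** y) ** z = delta *: ((x ** z) ** y + x ** (y ** z)).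

Definition eps_assoc (eps : F) A :=
  forall x y z : A, (x ** y) ** z = eps *: (x ** (y ** z)).

Definition assoc_alg A :=
  forall x y z : A, (x ** y) ** z = x ** (y ** z).

(* product_of A k x: x is the product of k elements of A, in some order and
   with some bracketing. *)
Inductive product_of A : nat -> A -> Prop :=
| product_one (x : A) : product_of 1 x
| product_mul m n (x y : A) :
    product_of m x -> product_of n y -> product_of (m + n) (x ** y).

Definition step_nilpotent (k : nat) A :=
  forall x : A, product_of k.+1 x -> x = 0.

Definition comm_leibniz (delta : F) A := comm_alg A /\ leibniz delta A.
Definition comm_eps_assoc (eps : F) A := comm_alg A /\ eps_assoc eps A.
Definition comm_assoc A := comm_alg A /\ assoc_alg A.
Definition comm_step_nilpotent (k : nat) A := comm_alg A /\ step_nilpotent k A.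

(* Expressions for the elements of the free nonassociative (nonunital)
   F-algebra on the variables tvar 0, tvar 1, etc. *)
Inductive term :=
| tvar of nat
| tadd of term & term
| tscale of F & term
| tmul of term & term.

Fixpoint eval A (v : nat -> A) (t : term) : A :=
  match t with
  | tvar i => v i
  | tadd s u => eval v s + eval v u
  | tscale a s => a *: eval v s
  | tmul s u => eval v s ** eval v u
  end.

Definition satisfies A (t : term) := forall v : nat -> A, eval v t = 0.

Definition is_variety K :=
  exists S : term -> Prop, forall A, K A <-> (forall t, S t -> satisfies A t).

Definition same_variety K L :=
  [/\ is_variety K, is_variety L & forall A, K A <-> L A].

Definition subvariety K L :=
  [/\ is_variety K, is_variety L & forall A, K A -> L A].

End Classes.

(* Main.v *)
From Pilot Require Import Defs.
From mathcomp Require Import all_boot all_order all_algebra.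
From mathcomp Require Import reals.
From mathcomp Require Import complex.
From mathcomp Require Import ring.

(** In a commutative algebra the three bracketings of x, y, z up to
    commutativity are a = (xy)z, b = (xz)y and c = (yz)x.

    The delta-Leibniz identity says a = delta (b + c), and its instances for the
    permuted variables say b = delta (a + c) and c = delta (a + b).  Subtracting
    two of these gives (1 + delta)(a - b) = 0, so delta <> -1 forces
    a = b = c: the algebra is associative, and the Leibniz identity is reduced
    to (1 - 2 delta) a = 0 ([comm_leibnizP]).

    The eps-associative identity gives a = eps c and b = eps c, hence again
    a = b = c, and it is reduced to (1 - eps) a = 0 ([comm_eps_assocP]).

    For eps = delta / (1 - delta) the factors 1 - 2 delta and 1 - eps differ by
    the nonzero factor 1 - delta, so the two classes agree
    ([comm_leibniz_eps_assoc]).  For delta = 1/2 both factors vanish and only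
    associativity is left; for any other delta every product of three elements
    vanishes, and a fortiori every product of four.

    All the classes are varieties because they are given by identities; for
    nilpotency the identities are the nonassociative monomials of the given
    degree ([step_nilpotent_variety]). *)

Set Implicit Arguments.
Unset Strict Implicit.
Unset Printing Implicit Defensive.

Import GRing.Theory Pilot.Defs.
Local Open Scope ring_scope.
Local Open Scope complex_scope.

(** * Commutative Leibniz and epsilon-associative algebras *)

Section Identities.

Variable F : fieldType.
Implicit Types (A : algebra F) (c delta eps : F).

Definition triple_torsion c A :=
  forall x y z : A, c *: ((x ** y) ** z) = 0.

(** With commutativity, associativity is invariance of (xy)z under swapping y
    and z; this is the form in which both classes give it. *)
Lemma comm_assoc_swap A :
  comm_assoc A <->
  comm_alg A /\ forall x y z : A, (x ** y) ** z = (x ** z) ** y.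
Proof.
split=> -[cA H]; split=> // x y z; first by rewrite !H (cA y).
by rewrite (cA x y) H cA (cA y).
Qed.

(** The variables y and z enter the right-hand side of the Leibniz identity for
    (xy)z almost symmetrically: exchanging them only exchanges (xz)y with (xy)z.
    So the difference of these two products equals -delta times itself,
    and vanishes when delta <> -1. *)
Lemma comm_leibnizP delta A : delta <> -1 ->
  comm_leibniz delta A <->
  comm_assoc A /\ triple_torsion (1 - 2 * delta) A.
Proof.
move=> /eqP dN1; split=> [[cA lA]|[[cA aA] tA]].
- have swap (x y z : A) : (x ** y) ** z = (x ** z) ** y.
    have E : (x ** y) ** z - (x ** z) ** y =
             delta *: ((x ** z) ** y - (x ** y) ** z).
      rewrite [X in X - _ = _]lA [X in _ - X = _]lA (cA z y).
      by rewrite -scalerBr [in X in _ - X]addrC addrKA.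
    have /eqP : (1 + delta) *: ((x ** y) ** z - (x ** z) ** y) = 0.
      by rewrite scalerDl scale1r {1}E -scalerDr addrC subrKA subrr scaler0.
    by rewrite scaler_eq0 addrC addr_eq0 (negPf dN1) subr_eq0 => /eqP.
  have asA : comm_assoc A by apply/comm_assoc_swap.
  split=> // x y z; rewrite scalerBl scale1r {1}lA -(asA.2 x y z) -swap.
  by rewrite -mulr2n -scaler_nat scalerA mulrC subrr.
- split=> // x y z; have /eqP := tA x y z.
  have -> : (x ** z) ** y = (x ** y) ** z by rewrite !aA (cA z).
  rewrite -(aA x y z) scalerBl scale1r subr_eq0 => /eqP {1}->.
  by rewrite -mulr2n -scaler_nat scalerA mulrC.
Qed.

(** By commutativity the right-hand side eps x(yz) is symmetric in y and z,
    hence so is (xy)z, for every eps. *)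
Lemma comm_eps_assocP eps A :
  comm_eps_assoc eps A <->
  comm_assoc A /\ triple_torsion (1 - eps) A.
Proof.
split=> [[cA eA]|[[cA aA] tA]].
- have asA : comm_assoc A.
    by apply/comm_assoc_swap; split=> // x y z; rewrite !eA (cA y).
  split=> // x y z; rewrite scalerBl scale1r {1}eA.
  by rewrite -(asA.2 x y z) subrr.
- split=> // x y z; have /eqP := tA x y z.
  by rewrite scalerBl scale1r subr_eq0 -(aA x y z) => /eqP.
Qed.

Lemma triple_torsionM c d A : c != 0 ->
  triple_torsion (c * d) A <-> triple_torsion d A.
Proof.
move=> c0; split=> tA x y z; last by rewrite -scalerA tA scaler0.
by have /eqP := tA x y z; rewrite -scalerA scaler_eq0 (negPf c0) => /eqP.
Qed.

Lemma comm_leibniz_eps_assoc delta A : delta <> -1 -> delta <> 1 ->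
  comm_leibniz delta A <-> comm_eps_assoc (delta / (1 - delta)) A.
Proof.
move=> dN1 /eqP d1; rewrite comm_leibnizP // comm_eps_assocP.
have d1' : 1 - delta != 0 by rewrite subr_eq0 eq_sym.
have -> : 1 - 2 * delta = (1 - delta) * (1 - delta / (1 - delta)) by field.
by rewrite triple_torsionM.
Qed.

Lemma comm_eps_assoc1 A : comm_eps_assoc 1 A <-> comm_assoc A.
Proof.
by split=> -[cA H]; split=> // x y z; have := H x y z; rewrite scale1r.
Qed.

End Identities.

(** * Products of several elements *)

Section Products.

Variables (F : fieldType) (A : algebra F).

Lemma product_of_split n (x : A) : product_of n x -> (1 < n)%N ->
  exists y z, x = y ** z.
Proof. by case=> // m p y z _ _ _; exists y, z. Qed.

(** In a product of at least three elements one of the two outermost factors is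
    itself a product. *)
Lemma comm_triple0_nilpotent k : comm_alg A -> triple_torsion 1 A ->
  step_nilpotent k.+2 A.
Proof.
move=> cA tA w Pw.
have t0 (x y z : A) : (x ** y) ** z = 0 by rewrite -[LHS]scale1r.
move: Pw; move En: k.+3 => n Pw; case: Pw En => // m p x y Px Py En.
have [m1|m_le1] := ltnP 1 m.
  by have [u [v ->]] := product_of_split Px m1.
have p1 : (1 < p)%N.
  rewrite -(ltn_add2l m) -En; exact: leq_trans (leq_add m_le1 (leqnn 1)) _.
by have [u [v ->]] := product_of_split Py p1; rewrite cA.
Qed.

End Products.

(** * The classes are varieties *)

Section Varieties.

Variable F : fieldType.
Implicit Types (K L : algebra F -> Prop) (t s : term F).

Lemma is_variety_and K L :
  is_variety K -> is_variety L -> is_variety (fun A => K A /\ L A).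
Proof.
move=> [S KS] [T LT]; exists (fun t => S t \/ T t) => A.
rewrite KS LT; split=> [[SA TA] t []|H]; [exact: SA|exact: TA|].
by split=> t tS; apply: H; [left|right].
Qed.

Lemma is_variety_equation K t s :
  (forall A, K A <-> forall v : nat -> A, eval v t = eval v s) ->
  is_variety K.
Proof.
move=> KE; exists (eq (tadd t (tscale (-1) s))) => A; rewrite KE.
split=> [H _ <- v|H v]; first by rewrite /= H scaleN1r subrr.
by apply/eqP; have /eqP := H _ erefl v; rewrite /= scaleN1r subr_eq0.
Qed.

Local Notation X i := (tvar F i).

Lemma comm_variety : is_variety (@comm_alg F).
Proof.
apply: (@is_variety_equation _ (tmul (X 0) (X 1)) (tmul (X 1) (X 0))) => A.
by split=> [cA v|H x y]; [exact: cA|exact: H (nth 0 [:: x; y])].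
Qed.

Lemma leibniz_variety delta : is_variety (@leibniz F delta).
Proof.
apply: (@is_variety_equation _ (tmul (tmul (X 0) (X 1)) (X 2))
  (tscale delta (tadd (tmul (tmul (X 0) (X 2)) (X 1))
                      (tmul (X 0) (tmul (X 1) (X 2)))))) => A.
by split=> [lA v|H x y z]; [exact: lA|exact: H (nth 0 [:: x; y; z])].
Qed.

Lemma eps_assoc_variety eps : is_variety (@eps_assoc F eps).
Proof.
apply: (@is_variety_equation _ (tmul (tmul (X 0) (X 1)) (X 2))
  (tscale eps (tmul (X 0) (tmul (X 1) (X 2))))) => A.
by split=> [eA v|H x y z]; [exact: eA|exact: H (nth 0 [:: x; y; z])].
Qed.

Lemma assoc_variety : is_variety (@assoc_alg F).
Proof.
apply: (@is_variety_equation _ (tmul (tmul (X 0) (X 1)) (X 2))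
  (tmul (X 0) (tmul (X 1) (X 2)))) => A.
by split=> [aA v|H x y z]; [exact: aA|exact: H (nth 0 [:: x; y; z])].
Qed.

Inductive monomial : nat -> term F -> Prop :=
| monomial_var i : monomial 1 (X i)
| monomial_mul m n t s :
    monomial m t -> monomial n s -> monomial (m + n) (tmul t s).

Lemma eval_monomial (A : algebra F) (v : nat -> A) n t :
  monomial n t -> product_of n (eval v t).
Proof. by elim=> [i|m p t1 t2 _ IH1 _ IH2] /=; constructor. Qed.

(** The factors are the values of the variables k, ..., k + n - 1.  The free
    offset k lets the two halves of a product use disjoint variables, so that
    their values can be chosen independently. *)
Lemma product_of_monomial (A : algebra F) n (x : A) : product_of n x ->
  forall k, exists t (w : nat -> A), monomial n t /\
    forall v : nat -> A,
      (forall i, (i < n)%N -> v (k + i)%N = w i) -> eval v t = x.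
Proof.
elim=> [{}x|m p y z _ IHy _ IHz] k.
  exists (X k), (fun=> x); split=> [|v H]; first exact: monomial_var.
  by rewrite /= -(H 0%N) // addn0.
have [t [w [Mt Ht]]] := IHy k; have [s [u [Ms Hs]]] := IHz (k + m)%N.
exists (tmul t s), (fun i => if (i < m)%N then w i else u (i - m)%N).
split=> [|v H]; first exact: monomial_mul.
rewrite /= Ht ?Hs // => i ltin.
  by rewrite -addnA H ?ltn_add2l // ltnNge leq_addr /= addKn.
by rewrite H ?ltin // ltn_addr.
Qed.

Lemma step_nilpotent_variety k : is_variety (@step_nilpotent F k).
Proof.
exists (monomial k.+1) => A; split=> [nA t Mt v|H x Px].
  exact/nA/eval_monomial.
have [t [w [Mt Ht]]] := product_of_monomial Px 0%N.
by rewrite -(Ht w) //; apply: H.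
Qed.

End Varieties.

Theorem theorem23 (R : realType) (delta : R[i])
    (deltaN1 : delta <> -1) (delta1 : delta <> 1) :
  [/\ same_variety (@comm_leibniz R[i] delta)
                   (@comm_eps_assoc R[i] (delta / (1 - delta))),
      same_variety (@comm_leibniz R[i] (1 / 2)) (@comm_assoc R[i])
    & delta <> 1 / 2 ->
      subvariety (@comm_leibniz R[i] delta) (@comm_step_nilpotent R[i] 3)].
Proof.
have vL d : is_variety (@comm_leibniz R[i] d).
  exact: (is_variety_and (comm_variety _) (leibniz_variety _)).
have two0 : (2 : R[i]) != 0 by rewrite Num.Theory.pnatr_eq0.
split.
- split=> [//||A]; last exact: comm_leibniz_eps_assoc.
  exact: (is_variety_and (comm_variety _) (eps_assoc_variety _)).
- split=> [//||A].
    exact: (is_variety_and (comm_variety _) (assoc_variety _)).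
  (* 1/2 differs from -1 and 1 because the characteristic is 0. *)
  rewrite comm_leibniz_eps_assoc -?comm_eps_assoc1.
  + by have -> : 1 / 2 / (1 - 1 / 2) = 1 :> R[i] by field.
  + move=> E; have /eqP[] : (3 : R[i]) != 0 by rewrite Num.Theory.pnatr_eq0.
    have -> : (3 : R[i]) = 2 * (1 / 2 - - 1) by field.
    by rewrite E subrr mulr0.
  + move=> E; have /eqP[] : (1 : R[i]) != 0 by rewrite oner_eq0.
    have -> : (1 : R[i]) = 2 * (1 - 1 / 2) by field.
    by rewrite E subrr mulr0.
- move=> dhalf; split=> [//||A].
    exact: (is_variety_and (comm_variety _) (step_nilpotent_variety _ _)).
  move=> /comm_leibnizP-/(_ deltaN1) [[cA _] tA]; split=> //.
  have c0 : 1 - 2 * delta != 0.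
    rewrite subr_eq0; apply/eqP => E; apply: dhalf.
    by apply: (mulfI two0); rewrite -E; field.
  apply: comm_triple0_nilpotent => //.
  by rewrite -(triple_torsionM _ _ c0) mulr1.
Qed.
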